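(* Let $N\ge1$ be an integer, $1\le j\le N$, and put $n=N+1$ and $k_0=\lfloor\frac{j+1}{2}\rfloor$. (i) If $j$ is odd, set $b_{k_0}=b_{k_0}'=\frac{1}{2\sqrt N}$ and let all other $b_k$ $(1\le k\le\lfloor\frac{n+1}2\rfloor)$ and $b_k'$ $(1\le k\le\lfloor\frac n2\rfloor)$ be $0$. Then \[ S_{N,j}(z)=4n\sum_{k=1}^{\lfloor n/2\rfloor}\left(b_k^2\cos^2\frac{(2k-1)\pi}{2n} + {b_k'}^2\sin^2\frac{(2k-1)\pi}{2n} \right)\frac{z}{1-2z\cos\frac{(2k-1)\pi}n+z^2} \] \[ -(1+z^n)(1-z^2)(1+z)^2\left(\sum_{k=1}^{\lfloor (n+1)/2\rfloor} \frac{b_k}{1-2z\cos\frac{(2k-1)\pi}n+z^2} \right)^2 \] \[ +(1+z^n)(1-z^2)(1-z)^2\left(\sum_{k=1}^{\lfloor n/2\rfloor} \frac{b_k'}{1-2z\cos\frac{(2k-1)\pi}n+z^2} \right)^2 +\left(\sum_{k=1}^{\lfloor (n+1)/2\rfloor} b_k \right)^2 -\left(\sum_{k=1}^{\lfloor n/2\rfloor} b_k' \right)^2 . \] (ii) If $j$ is even, set $c_{k_0}=c_{k_0}'=\frac{1}{2\sqrt N}$ and let all other $c_k$ $(1\le k\le\lfloor\frac{n}2\rfloor)$ and $c_k'$ $(1\le k\le\lfloor\frac{n-1}2\rfloor)$ be $0$. Then \[ S_{N,j}(z)=4n\sum_{k=1}^{\lfloor (n-1)/2\rfloor}\left(c_k^2\cos^2\frac{k\pi}{n}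 + {c_k'}^2\sin^2\frac{k\pi}{n} \right)\frac{z}{1-2z\cos\frac{2k\pi}n+z^2} \] \[ -(1-z^n)(1-z^2)(1+z)^2\left(\sum_{k=1}^{\lfloor n/2\rfloor} \frac{c_k}{1-2z\cos\frac{2k\pi}n+z^2} \right)^2 \] \[ +(1-z^n)(1-z^2)(1-z)^2\left(\sum_{k=1}^{\lfloor (n-1)/2\rfloor} \frac{c_k'}{1-2z\cos\frac{2k\pi}n+z^2} \right)^2 +\left(\sum_{k=1}^{\lfloor n/2\rfloor} c_k \right)^2 -\left(\sum_{k=1}^{\lfloor (n-1)/2\rfloor} c_k' \right)^2 . \] Both are identities of rational functions in $z$.
   Context: For integers $N\ge 1$ and $1\le j\le N$, the Suffridge polynomial is \[ S_{N,j}(z)= \sum_{k=1}^N \frac{N+1-k}{N}\, \frac{\sin\frac{kj\pi }{N+1}}{\sin\frac{j\pi}{N+1}}\, z^k . \] The right-hand sides are the two forms of Brandt's general representation of typically real polynomials, with specific choices of the coefficients. *)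

(* Defs.v *)
From mathcomp Require Import all_boot all_order all_algebra.
From mathcomp Require Import reals trigo.

Set Implicit Arguments.
Unset Strict Implicit.
Unset Printing Implicit Defensive.

Import GRing.Theory Num.Theory.
Local Open Scope ring_scope.

(* The field R(z) of rational functions, with its variable and constants.
   All coefficients involved are real, so identities in R(z) are identities
   in C(z). *)
Notation ratfun R := {fraction {poly R}}.

Definition ratz (R : realType) : ratfun R := FracField.tofrac ('X : {poly R}).

Definition ratc (R : realType) (a : R) : ratfun R := FracField.tofrac a%:P.

Definition suffridge (R : realType) (N j : nat) : {poly R} :=
  \sum_(1 <= k < N.+1)
    ((N%:R + 1 - k%:R) / N%:R
     * (sin (k%:R * j%:R * pi / (N%:R + 1)) / sin (j%:R * pi / (N%:R + 1))))
    *: 'X^k.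

(* 1 - 2 z cos t + z^2 *)
Definition quad (R : realType) (t : R) : ratfun R :=
  1 - 2 * ratz R * ratc (cos t) + ratz R ^+ 2.

(* The two forms of Brandt's general representation, for arbitrary coefficient
   families; only the values of b, b', c, c' at the summation indices matter. *)
Definition brandt_odd (R : realType) (n : nat) (b b' : nat -> R) : ratfun R :=
  let z := ratz R in
  4 * n%:R *
    (\sum_(1 <= k < (n./2).+1)
       ratc (b k ^+ 2 * cos ((2 * k%:R - 1) * pi / (2 * n%:R)) ^+ 2
             + b' k ^+ 2 * sin ((2 * k%:R - 1) * pi / (2 * n%:R)) ^+ 2)
       * (z / quad ((2 * k%:R - 1) * pi / n%:R)))
  - (1 + z ^+ n) * (1 - z ^+ 2) * (1 + z) ^+ 2
    * (\sum_(1 <= k < ((n.+1)./2).+1)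
         ratc (b k) / quad ((2 * k%:R - 1) * pi / n%:R)) ^+ 2
  + (1 + z ^+ n) * (1 - z ^+ 2) * (1 - z) ^+ 2
    * (\sum_(1 <= k < (n./2).+1)
         ratc (b' k) / quad ((2 * k%:R - 1) * pi / n%:R)) ^+ 2
  + ratc ((\sum_(1 <= k < ((n.+1)./2).+1) b k) ^+ 2)
  - ratc ((\sum_(1 <= k < (n./2).+1) b' k) ^+ 2).

Definition brandt_even (R : realType) (n : nat) (c c' : nat -> R) : ratfun R :=
  let z := ratz R in
  4 * n%:R *
    (\sum_(1 <= k < ((n.-1)./2).+1)
       ratc (c k ^+ 2 * cos (k%:R * pi / n%:R) ^+ 2
             + c' k ^+ 2 * sin (k%:R * pi / n%:R) ^+ 2)
       * (z / quad (2 * k%:R * pi / n%:R)))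
  - (1 - z ^+ n) * (1 - z ^+ 2) * (1 + z) ^+ 2
    * (\sum_(1 <= k < (n./2).+1)
         ratc (c k) / quad (2 * k%:R * pi / n%:R)) ^+ 2
  + (1 - z ^+ n) * (1 - z ^+ 2) * (1 - z) ^+ 2
    * (\sum_(1 <= k < ((n.-1)./2).+1)
         ratc (c' k) / quad (2 * k%:R * pi / n%:R)) ^+ 2
  + ratc ((\sum_(1 <= k < (n./2).+1) c k) ^+ 2)
  - ratc ((\sum_(1 <= k < ((n.-1)./2).+1) c' k) ^+ 2).

(* Main.v *)
Require Import Defs.
From mathcomp Require Import all_boot all_order all_algebra.
From mathcomp Require Import reals trigo zify ring.

Set Implicit Arguments.
Unset Strict Implicit.
Unset Printing Implicit Defensive.

Import GRing.Theory Num.Theory.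
Local Open Scope ring_scope.

(** Put t = j pi / n, q = 1 - 2 z cos t + z^2 and s = - cos (n t) = (-1)^(j+1).
    The numbers u_k = sin (k t) / sin t satisfy the recurrence with
    characteristic polynomial q and u_n = 0, so q * V = z (1 + s z^n) for
    V = sum_(k < n) u_k z^k.  Since N * S_{N,j} = n V - z V', differentiation
    gives N q^2 S_{N,j} = n z q - z (1 + s z^n) (1 - z^2).  This is also the
    right-hand side: only one summand survives in each sum, and
    (1 + z)^2 - (1 - z)^2 = 4 z. *)

(** The denominator [quad] as a polynomial, with [c] in place of the cosine: the argument below
    needs derivatives. *)
Definition quad_poly (K : comNzRingType) (c : K) : {poly K} :=
  1 - 2 * 'X * c%:P + 'X ^+ 2.

Section Generating.
Variables (K : comNzRingType) (c : K) (u : nat -> K).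
Hypotheses (u0 : u 0 = 0) (u1 : u 1 = 1).
Hypothesis uS : forall k, u k.+2 = 2 * c * u k.+1 - u k.

(** The recurrence cancels every coefficient of the product from degree 2 to [n]; only the two ends
    of the truncated generating function survive. *)
Lemma quad_poly_mul_sum n :
  quad_poly c * (\sum_(1 <= k < n.+1) u k *: 'X^k)
  = 'X - (u n.+1)%:P * 'X^(n.+1) + (u n)%:P * 'X^(n.+2).
Proof.
elim: n => [|n IHn].
  by rewrite big_geq // u0 u1; ring.
rewrite big_nat_recr //= mulrDr IHn uS -mul_polyC.
rewrite !rmorphB !rmorphM /= rmorph_nat /quad_poly !exprS; ring.
Qed.

Lemma quad_poly_sq_mul_weighted_sum N s :
  u N.+1 = 0 -> u N = s ->
  quad_poly c ^+ 2 * (\sum_(1 <= k < N.+1) ((N.+1%:R - k%:R) * u k) *: 'X^k)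
  = N.+1%:R * 'X * quad_poly c - 'X * (1 + s%:P * 'X^(N.+1)) * (1 - 'X ^+ 2).
Proof.
move=> un0 uNs; set V := \sum_(1 <= k < N.+1) u k *: 'X^k.
have -> : \sum_(1 <= k < N.+1) ((N.+1%:R - k%:R) * u k) *: 'X^k
          = N.+1%:R * V - 'X * V^`().
  rewrite /V raddf_sum /= !mulr_sumr -sumrB; apply: eq_big_nat => k /andP[k1 _].
  rewrite derivZ derivXn -!mul_polyC rmorphM rmorphB /= !rmorph_nat.
  by case: k k1 => // k _; rewrite /= -mulr_natr exprS; ring.
have qV : quad_poly c * V = 'X * (1 + s%:P * 'X^(N.+1)).
  by rewrite quad_poly_mul_sum un0 uNs !exprS; ring.
have dq : (quad_poly c)^`() = 2 * 'X - 2 * c%:P.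
  by rewrite /quad_poly !derivE; ring.
(* Regrouped so that [V] and its derivative occur only in q V and (q V)', both known from [qV]. *)
have -> : quad_poly c ^+ 2 * (N.+1%:R * V - 'X * V^`())
  = N.+1%:R * quad_poly c * (quad_poly c * V)
    - 'X * quad_poly c * ((quad_poly c)^`() * V + quad_poly c * V^`())
    + 'X * (quad_poly c)^`() * (quad_poly c * V) by ring.
rewrite -derivM qV dq !derivE /= -['X^N *+ _]mulr_natr /quad_poly !exprS; ring.
Qed.

End Generating.

Lemma quad_tofrac (R : realType) (x : R) :
  quad x = FracField.tofrac (quad_poly (cos x)).
Proof.
rewrite /quad /quad_poly.
by rewrite rmorphD rmorphB rmorphXn !rmorphM rmorph1 rmorph_nat.
Qed.

(** The constant term is 1 for every angle. *)
Lemma quad_neq0 (R : realType) (x : R) : quad x != 0.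
Proof.
rewrite quad_tofrac tofrac_eq0; apply/eqP => /(congr1 (fun p => p.[0])).
rewrite /quad_poly !hornerE /=; apply/eqP.
by rewrite subr0 expr0n addr0 oner_eq0.
Qed.

Lemma big_nat_single (V : nmodType) (F : nat -> V) m i :
  (1 <= i <= m)%N -> (forall k, (1 <= k <= m)%N -> k != i -> F k = 0) ->
  \sum_(1 <= k < m.+1) F k = F i.
Proof.
move=> hi F0; rewrite (bigD1_seq i) ?iota_uniq ?mem_index_iota //=.
rewrite big_nat_cond big1 ?addr0 // => k /andP[hk ki]; exact: F0.
Qed.

(** The common shape of both representations once each sum has a single term: [y] stands for z^n or
    - z^n, and [w ^+ 2] plays the role of 1/(4N). *)
Lemma brandt_single_term (F : fieldType) (N n w q y z S : F) :
  w ^+ 2 * (4 * N) = 1 -> q != 0 ->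
  q ^+ 2 * (N * S) = n * z * q - z * (1 + y) * (1 - z ^+ 2) ->
  S = 4 * n * (w ^+ 2 * (z / q))
      - (1 + y) * (1 - z ^+ 2) * (1 + z) ^+ 2 * (w / q) ^+ 2
      + (1 + y) * (1 - z ^+ 2) * (1 - z) ^+ 2 * (w / q) ^+ 2.
Proof.
move=> w2 q0 qS; apply: (mulfI (expf_neq0 2 q0)).
have -> : q ^+ 2 * S = w ^+ 2 * 4 * (q ^+ 2 * (N * S)).
  by rewrite -[LHS]mul1r -[X in X * _ = _]w2; ring.
by rewrite qS; field.
Qed.

Section Suffridge.
Variables (R : realType) (N j : nat).
Hypothesis hj : (1 <= j <= N)%N.

Let t : R := j%:R * pi / N.+1%:R.
Let s : R := (-1) ^+ j.+1.
Let v : R := 1 / (2 * Num.sqrt N%:R).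

Lemma suffridge_angle_sin_gt0 : 0 < sin t.
Proof.
have /andP[j1 jN] := hj.
apply: sin_gt0_pi; rewrite /t divr_gt0 ?mulr_gt0 ?ltr0n ?pi_gt0 //=.
by rewrite ltr_pdivrMr ?ltr0n // mulrC ltr_pM2l ?pi_gt0 // ltr_nat.
Qed.

Lemma quad_poly_sq_mul_suffridge :
  quad_poly (cos t) ^+ 2 * (N%:R * suffridge R N j)
  = N.+1%:R * 'X * quad_poly (cos t)
    - 'X * (1 + s%:P * 'X^(N.+1)) * (1 - 'X ^+ 2).
Proof.
have st0 : sin t != 0 by rewrite lt0r_neq0 // suffridge_angle_sin_gt0.
have N0 : N%:R != 0 :> R by rewrite pnatr_eq0; case/andP: hj => /leq_trans h /h;
  rewrite lt0n.
(* The summand 0 gives the form to which the sign change of sin and cos under a shift by pi applies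
   [j] times. *)
have tn : N.+1%:R * t = 0 + j%:R * pi.
  by rewrite /t add0r mulrC divfK // pnatr_eq0.
pose u k := sin (k%:R * t) / sin t.
have -> : N%:R * suffridge R N j
    = \sum_(1 <= k < N.+1) ((N.+1%:R - k%:R) * u k) *: 'X^k.
  rewrite /suffridge mulr_sumr; apply: eq_bigr => k _.
  rewrite -(rmorph_nat (@polyC R)) mul_polyC scalerA /u -natr1; congr (_ *: _).
  have -> : k%:R * j%:R * pi / (N%:R + 1) = k%:R * t by rewrite /t -natr1 !mulrA.
  have -> : j%:R * pi / (N%:R + 1) = t by rewrite /t -natr1.
  by field; rewrite N0 st0.
have sin_jpi : sin (N.+1%:R * t) = 0.
  by rewrite tn mulr_natl (alternatingn (@sinDpi R)) sin0 mulr0.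
have cos_jpi : cos (N.+1%:R * t) = (-1) ^+ j.
  by rewrite tn mulr_natl (alternatingn (@cosDpi R)) cos0 mulr1.
apply: (quad_poly_sq_mul_weighted_sum (u := u)).
- by rewrite /u mul0r sin0 mul0r.
- by rewrite /u mul1r divff.
- move=> k; rewrite /u.
  (* Both neighbours are expanded around (k+1) t; the cosine terms of the addition formulas cancel
     in their sum. *)
  have -> : k.+2%:R * t = k.+1%:R * t + t by rewrite -natr1 mulrDl mul1r.
  have -> : k%:R * t = k.+1%:R * t - t by rewrite -natr1; ring.
  by rewrite sinD sinB; field.
- by rewrite /u sin_jpi mul0r.
(* Since sin (n t) = 0, only - cos (n t) sin t remains of sin (n t - t). *)
- have -> : u N = sin (N.+1%:R * t - t) / sin t.
    by rewrite /u; congr (sin _ / _); rewrite -natr1; ring.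
  rewrite sinB sin_jpi cos_jpi /s exprS; field.
  exact: st0.
Qed.

(** The sign in [y] lets one formula cover both parities of [j]. *)
Lemma suffridge_tofrac (z := Defs.ratz R) (y := (-1) ^+ j.+1 * z ^+ N.+1) :
  FracField.tofrac (suffridge R N j) =
    4 * N.+1%:R * (ratc v ^+ 2 * (z / quad t))
    - (1 + y) * (1 - z ^+ 2) * (1 + z) ^+ 2 * (ratc v / quad t) ^+ 2
    + (1 + y) * (1 - z ^+ 2) * (1 - z) ^+ 2 * (ratc v / quad t) ^+ 2.
Proof.
have N0 : N%:R != 0 :> R by rewrite pnatr_eq0; case/andP: hj => /leq_trans h /h;
  rewrite lt0n.
have v2 : ratc v ^+ 2 * (4 * N%:R) = 1.
  have -> : 4 * N%:R = ratc (4 * N%:R : R).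
    by rewrite /ratc !rmorphM /= !rmorph_nat.
  rewrite /ratc -rmorphXn -rmorphM -rmorphXn -rmorphM /= /v expr_div_n exprMn.
  rewrite sqr_sqrtr ?ler0n // (_ : _ * _ = 1) ?rmorph1 //.
  by field.
have q0 : quad t != 0 by apply: quad_neq0.
have := quad_poly_sq_mul_suffridge; have := quad_tofrac t.
(* Abstracting q keeps its image whole while the embedding is distributed. *)
move: (quad_poly _) => Q qE /(congr1 (@FracField.tofrac _)).
rewrite !(rmorphXn, rmorphB, rmorphD, rmorphM, rmorph1, rmorph_nat) /=.
rewrite -qE -/(Defs.ratz R).
have -> : FracField.tofrac (-1)%:P = -1 :> ratfun R by rewrite !rmorphN !rmorph1.
by apply: brandt_single_term.
Qed.

End Suffridge.

Theorem mainTheorem3 (R : realType) (N j : nat)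
    (hN : (1 <= N)%N) (hj : (1 <= j <= N)%N) :
  let n := N.+1 in
  let k0 := (j.+1)./2 in
  let v : R := 1 / (2 * Num.sqrt N%:R) in
  (odd j ->
   forall b b' : nat -> R,
     (forall k, (1 <= k <= (n.+1)./2)%N -> b k = if k == k0 then v else 0) ->
     (forall k, (1 <= k <= n./2)%N -> b' k = if k == k0 then v else 0) ->
     FracField.tofrac (suffridge R N j) = brandt_odd n b b')
  /\
  (~~ odd j ->
   forall c c' : nat -> R,
     (forall k, (1 <= k <= n./2)%N -> c k = if k == k0 then v else 0) ->
     (forall k, (1 <= k <= (n.-1)./2)%N -> c' k = if k == k0 then v else 0) ->
     FracField.tofrac (suffridge R N j) = brandt_even n c c').
Proof.
move=> n k0 v; have /andP[j1 jN] := hj.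
have v2 (x : R) : ratc (v ^+ 2 * cos x ^+ 2 + v ^+ 2 * sin x ^+ 2) = ratc v ^+ 2.
  by rewrite -mulrDr cos2Dsin2 mulr1 /ratc !rmorphXn.
have r0 : ratc (0 : R) = 0 by rewrite /ratc !rmorph0.
rewrite (suffridge_tofrac R hj) -/v -/n; split=> jodd.
- move=> b b' hb hb'.
  (* For odd [j], 2 k0 = j + 1 <= n, so [k0] lies even in the shorter range. *)
  have k0m : (1 <= k0 <= n./2)%N by rewrite /k0 /n; lia.
  have k0m' : (1 <= k0 <= n.+1./2)%N by rewrite /k0 /n; lia.
  have bz k : (1 <= k <= n.+1./2)%N -> k != k0 -> b k = 0.
    by move=> /hb -> /negPf ->.
  have bz' k : (1 <= k <= n./2)%N -> k != k0 -> b' k = 0.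
    by move=> /hb' -> /negPf ->.
  have angle : (2 * k0%:R - 1) * pi / n%:R = j%:R * pi / n%:R :> R.
    rewrite [in RHS](_ : j = (k0 + k0).-1); last by rewrite /k0; lia.
    by rewrite -subn1 natrB ?natrD; [congr (_ * _ / _); ring | rewrite /k0; lia].
  rewrite /brandt_odd !(big_nat_single k0m) ?(big_nat_single k0m');
    do ?[by move=> k hk kk0; rewrite ?bz ?bz' ?r0 ?mul0r //; lia].
    (* The two constants are both the square of [v] and cancel. *)
    by rewrite hb // hb' // eqxx v2 angle addrK -signr_odd /= jodd /= expr0 mul1r.
  move=> k hk kk0; rewrite bz ?bz' //; last by lia.
  by rewrite expr0n /= !mul0r addr0 r0 mul0r.
- move=> c c' hc hc'.
  (* For even [j], 2 k0 = j <= n - 1. *)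
  have k0m : (1 <= k0 <= n.-1./2)%N by rewrite /k0 /n; lia.
  have k0m' : (1 <= k0 <= n./2)%N by rewrite /k0 /n; lia.
  have cz k : (1 <= k <= n./2)%N -> k != k0 -> c k = 0.
    by move=> /hc -> /negPf ->.
  have cz' k : (1 <= k <= n.-1./2)%N -> k != k0 -> c' k = 0.
    by move=> /hc' -> /negPf ->.
  have angle : 2 * k0%:R * pi / n%:R = j%:R * pi / n%:R :> R.
    by rewrite -natrM; congr (_%:R * _ / _); rewrite /k0; lia.
  rewrite /brandt_even !(big_nat_single k0m) ?(big_nat_single k0m');
    do ?[by move=> k hk kk0; rewrite ?cz ?cz' ?r0 ?mul0r //; lia].
    by rewrite hc // hc' // eqxx v2 angle addrK -signr_odd /= jodd /= expr1 mulN1r.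
  move=> k hk kk0; rewrite cz ?cz' //; last by lia.
  by rewrite expr0n /= !mul0r addr0 r0 mul0r.
Qed.
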